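(* Suppose that for each $d\in\mathcal D$ the monotone treatment selection and monotone instrumental variable conditions hold in the same direction, i.e. either (i) $\ell\mapsto \mathrm{E}[Y_d\mid D=\ell]$ and $z\mapsto \mathrm{E}[Y_d\mid Z=z]$ are both nondecreasing, or (ii) $\ell\mapsto \mathrm{E}[Y_d\mid D=\ell]$ and $z\mapsto \mathrm{E}[Y_d\mid Z=z]$ are both nonincreasing. Then $Z$ is a binarized MTS-MIV for $D$, i.e. for each $d\in\mathcal D$, $$\big(\mathrm{E}[Y_d\mid D\ge j]-\mathrm{E}[Y_d\mid D<j]\big)\big(\mathrm{E}[Y_d\mid Z\ge z]-\mathrm{E}[Y_d\mid Z<z]\big)\ge 0\quad\text{for all } j,z.$$
   Context: Setting: all random variables live on one probability space. $D$ is a discrete random variable (treatment) with values in $\mathcal D=\{1,2,\dots,T\}$; for each $d\in\mathcal D$, $Y_d$ is an integrable real random variable (potential outcome); $Z$ is a real random variable (imperfect instrument) with values in $\mathcal Z\subseteq\mathbb R$. No independence is assumed. Monotone treatment selection (MTS): $\mathrm{E}[Y_d\mid D=\ell]$ is monotone in $\ell$ for all $d$. Monotone instrumental variable (MIV): $\mathrm{E}[Y_d\mid Z=z]$ (some version of it) is monotone in $z$ for all $d$. Binarized MTS-MIV: with $g_d^+(j)=\mathrm{E}[Y_d\mid D\ge j]$, $g_d^-(j)=\mathrm{E}[Y_d\mid D<j]$, $h_d^+(z)=\mathrm{E}[Y_d\mid Z\ge z]$, $h_d^-(z)=\mathrm{E}[Y_d\mid Z<z]$, the variable $Z$ is called a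 binarized MTS-MIV for $D$ if for each $d\in\mathcal D$, $(g_d^+(j)-g_d^-(j))(h_d^+(z)-h_d^-(z))\ge 0$ for all $j,z$. Convention: values $j,\ell,z$ range over those for which the conditional expectations involved are defined (for events: the conditioning events $\{D\ge j\},\{D<j\},\{D=\ell\},\{Z\ge z\},\{Z<z\}$ have positive probability). *)

(* Defs.v *)
From HB Require Import structures.
From mathcomp Require Import all_boot all_order all_algebra.
From mathcomp Require Import all_classical all_reals all_analysis.

Set Implicit Arguments.
Unset Strict Implicit.
Unset Printing Implicit Defensive.

Import Order.TTheory GRing.Theory Num.Theory.
Import numFieldNormedType.Exports.

Local Open Scope classical_set_scope.
Local Open Scope ring_scope.

Section BinarizedMTSMIV.
Context {disp : measure_display} {Omega : measurableType disp} {R : realType}.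
Variable P : probability Omega R.

(* E[X | A].  Meaningful only when P A > 0 (otherwise it is 0, as x / 0 = 0);
   every use below is guarded by this condition. *)
Definition cond_expectation (X : Omega -> R) (A : set Omega) : R :=
  (\int[P]_(w in A) X w)%R / fine (P A).

(* h is a version of z |-> E[X | Z = z], i.e. h \o Z is a version of the
   conditional expectation of X given the sigma-algebra generated by Z. *)
Definition is_regression (X Z : Omega -> R) (h : R -> R) : Prop :=
  [/\ measurable_fun setT h,
      P.-integrable setT (EFin \o (h \o Z)) &
      forall B : set R, measurable B ->
        (\int[P]_(w in Z @^-1` B) (h (Z w))%:E =
         \int[P]_(w in Z @^-1` B) (X w)%:E)%E].

Definition MTS_nondecreasing (D : Omega -> nat) (X : Omega -> R) : Prop :=
  {in [set l | (0 < P (D @^-1` [set l]))%E] &,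
   {homo (fun l => cond_expectation X (D @^-1` [set l])) :
      l m / (l <= m)%N >-> l <= m}}.

Definition MTS_nonincreasing (D : Omega -> nat) (X : Omega -> R) : Prop :=
  {in [set l | (0 < P (D @^-1` [set l]))%E] &,
   {homo (fun l => cond_expectation X (D @^-1` [set l])) :
      l m / (l <= m)%N >-> m <= l}}.

(* The version h is defined on all of R, but only its restriction to the value
   set S of Z is constrained; this loses nothing, since a Borel function on a
   subset of R extends to a Borel function on R. *)
Definition MIV_nondecreasing (S : set R) (Z X : Omega -> R) : Prop :=
  exists2 h : R -> R, is_regression X Z h &
    {in S &, {homo h : z z' / z <= z' >-> z <= z'}}.

Definition MIV_nonincreasing (S : set R) (Z X : Omega -> R) : Prop :=
  exists2 h : R -> R, is_regression X Z h &
    {in S &, {homo h : z z' / z <= z' >-> z' <= z}}.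

Definition binarized_MTS_MIV (T : nat) (D : Omega -> nat)
    (Y : nat -> Omega -> R) (Z : Omega -> R) : Prop :=
  forall d : nat, (1 <= d <= T)%N ->
  forall (j : nat) (z : R),
    (0 < P [set w | (j <= D w)%N])%E -> (0 < P [set w | (D w < j)%N])%E ->
    (0 < P [set w | (z <= Z w)%R])%E -> (0 < P [set w | (Z w < z)%R])%E ->
    0 <= (cond_expectation (Y d) [set w | (j <= D w)%N]
          - cond_expectation (Y d) [set w | (D w < j)%N])
       * (cond_expectation (Y d) [set w | z <= Z w]
          - cond_expectation (Y d) [set w | Z w < z]).

End BinarizedMTSMIV.

(* Main.v *)
(* Replacing Y_d by - Y_d, one may assume that both maps are nondecreasing, and
   then both factors are nonnegative. For D, after clearing denominators, the
   difference is the sum over m < j <= l of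
     P(D = l) P(D = m) (E[Y_d | D = l] - E[Y_d | D = m]).
   For Z, the supremum of the regression function over the values taken on
   {Z < z} separates the two conditional means. *)

Require Import Defs.
From HB Require Import structures.
From mathcomp Require Import all_boot all_order all_algebra.
From mathcomp Require Import all_classical all_reals all_analysis.

Set Implicit Arguments.
Unset Strict Implicit.
Unset Printing Implicit Defensive.

Import Order.TTheory GRing.Theory Num.Theory.
Import numFieldNormedType.Exports.

Local Open Scope classical_set_scope.
Local Open Scope ring_scope.

Section ConditionalMeans.
Context {disp : measure_display} {Omega : measurableType disp} {R : realType}.
Variable P : probability Omega R.
Implicit Types (X : Omega -> R) (A B : set Omega).

(** Every set of naturals is measurable, so any predicate on the values of [D] defines an event. *)
Lemma measurable_pred_nat (D : {RV P >-> nat}) (J : pred nat) :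
  measurable [set w | J (D w)].
Proof. exact: (measurable_funPTI D (Y := [set l | J l])). Qed.

Lemma preimage_set_ge (Z : Omega -> R) z :
  [set w | z <= Z w] = Z @^-1` `[z, +oo[%classic.
Proof. by apply/seteqP; split => w /=; rewrite in_itv/= andbT. Qed.

Lemma preimage_set_lt (Z : Omega -> R) z :
  [set w | Z w < z] = Z @^-1` `]-oo, z[%classic.
Proof. by apply/seteqP; split => w /=; rewrite in_itv. Qed.

Lemma measurable_ge_RV (Z : {RV P >-> R}) z : measurable [set w | z <= Z w].
Proof. by rewrite preimage_set_ge; exact: measurable_funPTI. Qed.

Lemma measurable_lt_RV (Z : {RV P >-> R}) z : measurable [set w | Z w < z].
Proof. by rewrite preimage_set_lt; exact: measurable_funPTI. Qed.

Lemma fine_probability_gt0 A :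
  measurable A -> (0 < P A)%E -> 0 < fine (P A).
Proof.
move=> mA PA; apply: fine_gt0; rewrite PA/=.
by rewrite (le_lt_trans (probability_le1 P mA))// ltry.
Qed.

Lemma integrable_subset X A :
  measurable A -> P.-integrable setT (EFin \o X) -> P.-integrable A (EFin \o X).
Proof. by move=> mA iX; exact: (integrableS measurableT). Qed.

(** If [P A = 0], both sides vanish, the integral being over a null set. Hence sums over all values
    of [D] can be rewritten uniformly, null values included. *)
Lemma Rintegral_cond_expectation X A :
    measurable A -> P.-integrable setT (EFin \o X) ->
  (\int[P]_(w in A) X w)%R = fine (P A) * cond_expectation P X A.
Proof.
move=> mA iX; have [PA0|PA0] := eqVneq (P A) 0%E.
  rewrite PA0 mul0r /Rintegral null_set_integral//.
  exact: (measurable_int P (integrable_subset mA iX)).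
rewrite /cond_expectation mulrCA divff ?mulr1// gt_eqF//.
by rewrite fine_probability_gt0// lt0e PA0 measure_ge0.
Qed.

Lemma cond_expectationN X A :
    measurable A -> P.-integrable setT (EFin \o X) ->
  cond_expectation P (\- X) A = - cond_expectation P X A.
Proof.
move=> mA iX; rewrite /cond_expectation -mulNr; congr (_ / _).
rewrite -mulN1r -RintegralZl//; last exact: integrable_subset.
by apply: eq_Rintegral => w _; rewrite mulN1r.
Qed.

(** The event is a finite disjoint union of fibres of [D], and the integral is additive over it. *)
Lemma Rintegral_preimage_nat (D : {RV P >-> nat}) X (N : nat) (J : pred nat) :
    (forall w, (D w < N)%N) -> P.-integrable setT (EFin \o X) ->
  (\int[P]_(w in [set w | J (D w)]) X w)%R =
  \sum_(0 <= l < N | J l) (\int[P]_(w in D @^-1` [set l]) X w)%R.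
Proof.
move=> DN iX; have mD l : measurable (D @^-1` [set l]).
  exact: measurable_funPTI.
have -> : [set w | J (D w)] =
    \big[setU/set0]_(l <- [seq l <- index_iota 0 N | J l]) (D @^-1` [set l]).
  rewrite -bigcup_seq; apply/seteqP; split => [w /= Jw|w [l /=]].
    by exists (D w) => //=; rewrite mem_filter Jw mem_index_iota DN.
  by rewrite mem_filter => /andP[Jl _] ->.
rewrite /Rintegral integral_bigsetU_EFin//.
- rewrite -[RHS]big_filter sum_fine// => l _.
  by apply: integrable_fin_num => //; exact: integrable_subset.
- by rewrite filter_uniq// iota_uniq.
- by move=> l m _ _ [w [/= <- <-]].
- apply: (measurable_funS measurableT) => //; exact: (measurable_int P).
Qed.

Lemma le_cond_expectation_MTS (D : {RV P >-> nat}) X (N j : nat) :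
    (forall w, (D w < N)%N) -> P.-integrable setT (EFin \o X) ->
    MTS_nondecreasing P D X ->
    (0 < P [set w | (j <= D w)%N])%E -> (0 < P [set w | (D w < j)%N])%E ->
  cond_expectation P X [set w | (D w < j)%N] <=
  cond_expectation P X [set w | (j <= D w)%N].
Proof.
move=> DN iX mts.
have mpre := measurable_pred_nat D.
have mD l : measurable (D @^-1` [set l]) by exact: measurable_funPTI.
move=> /(fine_probability_gt0 (mpre (leq j))) PA.
move=> /(fine_probability_gt0 (mpre (gtn j))) PB.
(* Probabilities are integrals of the constant 1, so the same fibre decomposition applies to
   them. *)
have PE (J : pred nat) : fine (P [set w | J (D w)]) =
    \sum_(0 <= l < N | J l) fine (P (D @^-1` [set l])).
  rewrite -[LHS]mul1r -Rintegral_cst// (Rintegral_preimage_nat J DN).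
    by apply: eq_bigr => l _; rewrite Rintegral_cst// mul1r.
  exact: finite_measure_integrable_cst.
rewrite /cond_expectation ler_pdivrMr// mulrAC ler_pdivlMr//.
rewrite (Rintegral_preimage_nat (leq j) DN iX).
rewrite (Rintegral_preimage_nat (gtn j) DN iX).
(* Commuting the left product puts the sum over [j <= l] outermost on both sides; the two double
   sums then compare term by term. *)
rewrite (PE (leq j)) (PE (gtn j)) mulrC !big_distrl/=.
rewrite [leRHS](eq_bigr (fun l => \sum_(0 <= m < N | (m < j)%N)
  (\int[P]_(w in D @^-1` [set l]) X w)%R * fine (P (D @^-1` [set m])))); last first.
  by move=> l _; rewrite big_distrr.
rewrite [leLHS](eq_bigr (fun l => \sum_(0 <= m < N | (m < j)%N)
  fine (P (D @^-1` [set l])) * (\int[P]_(w in D @^-1` [set m]) X w)%R)); last first.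
  by move=> l _; rewrite big_distrr.
apply: ler_sum => l jl; apply: ler_sum => m mj.
rewrite !Rintegral_cond_expectation// mulrCA [leRHS]mulrC.
(* Monotonicity concerns only values of positive probability; if [l] or [m] is a null value, both
   terms are zero. *)
have [Pl0|Pl0] := eqVneq (P (D @^-1` [set l])) 0%E.
  by rewrite Pl0 /= !mul0r !mulr0.
have [Pm0|Pm0] := eqVneq (P (D @^-1` [set m])) 0%E.
  by rewrite Pm0 /= !mul0r.
rewrite ler_wpM2l// ?fine_ge0// ler_wpM2l// ?fine_ge0//.
apply: mts; rewrite ?inE/= ?lt0e ?Pl0 ?Pm0 ?measure_ge0//.
exact: (leq_trans (ltnW mj)).
Qed.

Lemma le_cond_expectation_MIV (S : set R) (Z : {RV P >-> R}) X (z : R) :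
    (forall w, S (Z w)) -> MIV_nondecreasing P S Z X ->
    (0 < P [set w | (z <= Z w)%R])%E -> (0 < P [set w | (Z w < z)%R])%E ->
  cond_expectation P X [set w | Z w < z] <=
  cond_expectation P X [set w | z <= Z w].
Proof.
move=> SZ [h [mh ih hE] hmono].
have hmonoZ w w' : Z w <= Z w' -> h (Z w) <= h (Z w').
  by apply: hmono; rewrite inE.
(* On events determined by [Z], [X] may be replaced by [h \o Z], so both conditional means become
   averages of a monotone function of [Z]. *)
have hint (C : set R) : measurable C ->
    (\int[P]_(w in Z @^-1` C) X w)%R = (\int[P]_(w in Z @^-1` C) h (Z w))%R.
  by move=> mC; rewrite /Rintegral hE.
set A := [set w | z <= Z w]; set B := [set w | Z w < z].
have AE : A = Z @^-1` `[z, +oo[%classic by exact: preimage_set_ge.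
have BE : B = Z @^-1` `]-oo, z[%classic by exact: preimage_set_lt.
have mA : measurable A by exact: measurable_ge_RV.
have mB : measurable B by exact: measurable_lt_RV.
move=> PA PB.
have nonempty C : (0 < P C)%E -> C !=set0.
  by move=> PC; apply/set0P/eqP => C0; rewrite C0 measure0 ltxx in PC.
(* These points make [c] below a genuine least upper bound: [h (Z a)] bounds the set from above, and
   [h (Z b)] belongs to it. *)
have [a Aa] := nonempty _ PA; have [b Bb] := nonempty _ PB.
pose c := sup [set h (Z w) | w in B].
have le_c w : B w -> h (Z w) <= c.
  move=> Bw; apply: ub_le_sup; last by exists w.
  by exists (h (Z a)) => _ [v Bv <-]; apply: hmonoZ; exact: ltW (lt_le_trans Bv Aa).
have ge_c w : A w -> c <= h (Z w).
  move=> Aw; apply: ge_sup; first by exists (h (Z b)), b.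
  by move=> _ [v Bv <-]; apply: hmonoZ; exact: ltW (lt_le_trans Bv Aw).
have ihS C : measurable C -> P.-integrable C (EFin \o (h \o Z)).
  by move=> mC; exact: integrable_subset.
have icst C : measurable C -> P.-integrable C (EFin \o cst c).
  by move=> mC; exact: finite_measure_integrable_cst.
(* Each mean is compared with [c] by integrating the pointwise bound: the constant [c] integrates to
   [c] times the probability of the event. *)
apply: (@le_trans _ _ c).
  rewrite /cond_expectation ler_pdivrMr ?fine_probability_gt0//.
  by rewrite -Rintegral_cst// [in leLHS]BE hint// -BE;
    exact: (le_Rintegral mB (ihS _ mB) (icst _ mB)).
rewrite /cond_expectation ler_pdivlMr ?fine_probability_gt0//.
by rewrite -Rintegral_cst// [in leRHS]AE hint// -AE;
  exact: (le_Rintegral mA (icst _ mA) (ihS _ mA)).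
Qed.

Lemma MTS_nonincreasingN (D : {RV P >-> nat}) X :
    P.-integrable setT (EFin \o X) ->
  MTS_nonincreasing P D X -> MTS_nondecreasing P D (\- X).
Proof.
move=> iX mts l m lP mP lm.
have mD k : measurable (D @^-1` [set k]) by exact: measurable_funPTI.
by rewrite !cond_expectationN// lerN2; exact: mts.
Qed.

(** By linearity, negating a version of the regression of [X] gives one for [\- X]. *)
Lemma MIV_nonincreasingN (S : set R) (Z : {RV P >-> R}) X :
    P.-integrable setT (EFin \o X) ->
  MIV_nonincreasing P S Z X -> MIV_nondecreasing P S Z (\- X).
Proof.
move=> iX [h [mh ih hE] hmono]; exists (\- h); last first.
  by move=> z z' Sz Sz' zz'; rewrite lerN2; exact: hmono.
have ZN (C : set R) (f : Omega -> R) : measurable C ->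
    P.-integrable setT (EFin \o f) ->
    (\int[P]_(w in Z @^-1` C) (- f w)%:E =
     - \int[P]_(w in Z @^-1` C) (f w)%:E)%E.
  move=> mC i_f; under eq_integral do rewrite EFinN.
  have mZC : measurable (Z @^-1` C) by exact: measurable_funPTI.
  (* The sign leaves an extended-real integral provided the positive and negative parts are not both
     infinite, which integrability ensures. *)
  rewrite integralN//; apply: (integrable_add_def mZC).
  exact: integrable_subset.
split.
- exact: measurableT_comp.
- by have := integrableN ih.
- by move=> C mC; rewrite (ZN C (h \o Z))// (ZN C X)//= hE.
Qed.

End ConditionalMeans.

Theorem lemma2p1 (disp : measure_display) (Omega : measurableType disp)
    (R : realType) (P : probability Omega R)
    (T : nat) (D : {RV P >-> nat}) (Y : nat -> {RV P >-> R})
    (S : set R) (Z : {RV P >-> R})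
    (D_values : forall w, (1 <= D w <= T)%N)
    (Z_values : forall w, S (Z w))
    (Y_integrable : forall d, (1 <= d <= T)%N ->
       P.-integrable setT (EFin \o Y d))
    (same_direction : forall d, (1 <= d <= T)%N ->
       (MTS_nondecreasing P D (Y d) /\ MIV_nondecreasing P S Z (Y d)) \/
       (MTS_nonincreasing P D (Y d) /\ MIV_nonincreasing P S Z (Y d))) :
  binarized_MTS_MIV P T D Y Z.
Proof.
move=> d dT j z PA PB PA' PB'.
(* The sums over values of [D] use the half-open range from 0, so the bound is [T.+1]; the extra
   value 0 has an empty fibre. *)
have DT w : (D w < T.+1)%N by have /andP[] := D_values w.
have iY := Y_integrable d dT.
have [[mts miv]|[mts miv]] := same_direction d dT.
  by rewrite mulr_ge0// subr_ge0; [exact: (le_cond_expectation_MTS DT)|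
    exact: (le_cond_expectation_MIV Z_values)].
have iNY : P.-integrable setT (EFin \o \- (Y d)).
  by have := integrableN iY.
have := le_cond_expectation_MTS DT iNY (MTS_nonincreasingN iY mts) PA PB.
have := le_cond_expectation_MIV Z_values (MIV_nonincreasingN iY miv) PA' PB'.
have mA := measurable_ge_RV Z z; have mB := measurable_lt_RV Z z.
have mC := measurable_pred_nat D (leq j).
have mE := measurable_pred_nat D (gtn j).
(* Undoing the negation reverses both inequalities: both factors are nonpositive, and their product
   is nonnegative. *)
by rewrite !cond_expectationN// !lerN2 => ? ?; rewrite mulr_le0// subr_le0.
Qed.
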